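(* Let $n\ge 3$ be an integer, let $l=\lfloor n/2\rfloor$ and $h=\lceil n/2\rceil$, and let $K=\{123,321\}\{132,231\}$. The number of equivalence classes of $S_n$ under $K$-equivalence is $$\sum_{j=1}^{l} j!\cdot\binom{n-j-1}{h-1}+\sum_{j=1}^{h} j!\cdot\binom{n-j-1}{l-1}.$$
   Context: Permutations in $S_n$ are written as words $\pi_1\pi_2\cdots\pi_n$ in one-line notation. The order permutation of a word $u$ of $c$ distinct positive integers is the unique $\sigma\in S_c$ with $\sigma_i<\sigma_j$ iff $u_i<u_j$. A replacement partition $K$ of $S_c$ is a set partition of $S_c$; it is denoted by listing its parts with the one-element parts (and outer brackets) omitted, so here $K$ is the set partition of $S_3$ whose only parts of size greater than one are $\{123,321\}$ and $\{132,231\}$. The $K$-equivalence on $S_n$ is the equivalence relation generated by: $\phi\equiv\psi$ whenever $\phi=aub$ and $\psi=avb$ (concatenations) for some possibly empty words $a,b$ and words $u,v$ of length $c$ (so $u,v$ occupy the same $c$ consecutive positions) such that the order permutations of $u$ and $v$ lie in the same part of $K$. All equivalence classes are counted, including one-element classes. *)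

(* Defs.v *)
From mathcomp Require Import all_boot all_fingroup.

Set Implicit Arguments.
Unset Strict Implicit.
Unset Printing Implicit Defensive.

(* Over the alphabet 'I_n the letter i stands for the positive integer i.+1:
   the shift does not affect comparisons between letters. *)
Definition word (n : nat) (s : 'S_n) : seq 'I_n := [seq s i | i <- enum 'I_n].

Definition is_order_perm (n c : nat) (u : c.-tuple 'I_n) (s : 'S_c) : bool :=
  [forall i, forall j, (s i < s j) == (tnth u i < tnth u j)].

(* The permutations of S_c whose one-line notation, with the letters 1..c,
   occurs in ws. *)
Definition one_line (c : nat) (ws : seq (seq nat)) : {set 'S_c} :=
  [set s : 'S_c | [seq (val i).+1 | i <- word s] \in ws].

(* The set partition of S_c denoted by the listing L of its parts in which
   one-element parts may be omitted. *)
Definition replacement_partition (c : nat) (L : {set {set 'S_c}}) :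
    {set {set 'S_c}} :=
  L :|: [set [set s] | s in ~: cover L].

(* The prefix a and the suffix b are subwords of a word of length n, so their
   lengths are at most n; bounding them keeps the relation boolean. *)
Definition K_step (n c : nat) (K : {set {set 'S_c}}) (phi psi : 'S_n) : bool :=
  [exists a : n.-bseq 'I_n, exists b : n.-bseq 'I_n,
   exists u : c.-tuple 'I_n, exists v : c.-tuple 'I_n,
   [&& word phi == a ++ u ++ b,
       word psi == a ++ v ++ b &
       [exists part in K, exists s in part, exists t in part,
          is_order_perm u s && is_order_perm v t]]].

(* As K_step is symmetric (K_stepC below), its reflexive transitive closure is
   the equivalence relation it generates. *)
Definition K_equiv (n c : nat) (K : {set {set 'S_c}}) : rel 'S_n :=
  connect (K_step K).

Definition num_classes (n c : nat) (K : {set {set 'S_c}}) : nat :=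
  #|equivalence_partition (@K_equiv n c K) [set: 'S_n]|.

Lemma K_stepC (n c : nat) (K : {set {set 'S_c}}) :
  symmetric (@K_step n c K).
Proof.
suff H phi psi : @K_step n c K phi psi -> K_step K psi phi.
  by move=> phi psi; apply/idP/idP; apply: H.
case/existsP=> a /existsP[b] /existsP[u] /existsP[v] /and3P[Ephi Epsi].
case/existsP=> B /andP[KB] /existsP[s] /andP[Bs] /existsP[t] /and3P[Bt us vt].
apply/existsP; exists a; apply/existsP; exists b.
apply/existsP; exists v; apply/existsP; exists u; rewrite Ephi Epsi /=.
apply/existsP; exists B; rewrite KB /=; apply/existsP; exists t; rewrite Bt /=.
by apply/existsP; exists s; rewrite Bs vt us.
Qed.

Lemma K_equiv_equivalence (n c : nat) (K : {set {set 'S_c}}) :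
  equivalence_rel (@K_equiv n c K).
Proof.
have symK : connect_sym (@K_step n c K).
  exact/sym_connect_sym/K_stepC.
by apply/equivalence_relP; split; [apply: connect0 | apply: same_connect].
Qed.

Lemma replacement_partitionP (c : nat) (L : {set {set 'S_c}}) :
  trivIset L -> set0 \notin L -> partition (replacement_partition L) [set: 'S_c].
Proof.
move=> tL L0; apply/and3P; split.
- rewrite eqEsubset subsetT /=; apply/subsetP=> s _.
  have [sL|sL] := boolP (s \in cover L).
    have [B LB Bs] := bigcupP sL.
    by apply/bigcupP; exists B; rewrite // inE LB.
  apply/bigcupP; exists [set s]; rewrite ?set11 // inE.
  by rewrite imset_f ?orbT // inE.
- have disj A s : A \in L -> s \in ~: cover L -> [disjoint A & [set s]].
    move=> LA; rewrite inE => sL; rewrite disjoint_sym disjoints1.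
    by apply: contra sL => As; apply/bigcupP; exists A.
  apply/trivIsetP=> A B; rewrite !inE.
  case/orP=> [LA|/imsetP[s sL ->]] /orP[LB|/imsetP[t tL' ->]] nAB.
  + exact: (trivIsetP tL).
  + exact: disj.
  + by rewrite disjoint_sym; apply: disj.
  + by rewrite disjoints1 inE; apply: contra nAB => /eqP->.
- rewrite inE negb_or L0 /=; apply/imsetP=> -[s _ E].
  by have := set11 s; rewrite -E inE.
Qed.

(* Main.v *)
Require Import Defs.
From mathcomp Require Import all_boot all_fingroup zify.

(** A move reverses three consecutive letters x y z whose middle letter y is not
    the smallest. It thus exchanges two letters that are neighbours among the
    positions of one parity, and the letters in odd positions form a fixed set A,
    of size h, as do those in even positions. A letter is called dominant when it
    is larger than all the letters in positions of the other parity; since the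
    letter separating two dominant letters is smaller than both, two dominant
    letters are never exchanged, and their relative order is invariant
    ([kstep_tops]).

    These invariants are complete ([keq_complete]), by induction on the length.
    Call a letter in even position small if it is below all letters in odd
    positions; small letters move freely within the even positions
    ([rearrange_small]). If all of them are small, every letter in odd position is
    dominant and the claim is clear. Otherwise the minimum m of the odd positions
    can be moved to the front: bring a letter larger than m just before m, which
    is possible because only small letters stand in its way, and exchange m with
    its left neighbour of the same parity ([min_to_front]). Deleting m from the
    front leaves a shorter word with the parities exchanged and the same dominant
    letters.

    The classes are therefore counted by the sets A of size h together with an
    ordering of the dominant letters of each parity ([count_invariants]). The
    dominant letters lie all on the side of the largest letter; there are j of
    them when the j largest letters are on that side and the next one is on the
    other. For the odd side, C(n-j-1, h-j) = C(n-j-1, l-1) sets A are of this kind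
    ([card_dominant_eq]), which gives the second sum; the first one is the same
    count for the complement of A. *)

Set Implicit Arguments.
Unset Strict Implicit.
Unset Printing Implicit Defensive.

(** * Subwords in alternating positions *)

Section Alt.
Variable T : eqType.
Implicit Types (s t p q : seq T) (b : bool).

(** The letters of [s] in every other position, beginning with the first one if
    [b] and with the second one otherwise. With positions counted from 1,
    [alt true s] is the subword in odd positions and [alt false s] the subword
    in even positions. *)
Fixpoint alt b s : seq T :=
  if s is x :: s' then
    if b then x :: alt false s' else alt true s'
  else [::].

Lemma alt_cat b s t : alt b (s ++ t) = alt b s ++ alt (b (+) odd (size s)) t.
Proof.
elim: s b => [|x s IHs] [] //=; rewrite IHs ?addbT ?addFb ?addTb ?negbK //.
Qed.

Lemma size_alt b s : size (alt b s) = if b then uphalf (size s) else (size s)./2.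
Proof. by elim: s b => [|x s IHs] [] //=; rewrite IHs // uphalfE. Qed.

Lemma perm_alt s : perm_eq (alt true s ++ alt false s) s.
Proof.
elim: s => [|x s IHs] //=; rewrite perm_cons.
by rewrite (perm_trans _ IHs) // perm_catC.
Qed.

Lemma alt_perm s t :
  (forall b, perm_eq (alt b s) (alt b t)) -> perm_eq s t.
Proof.
move=> st; rewrite -(permPl (perm_alt s)) -(permPr (perm_alt t)).
exact: perm_cat.
Qed.

Lemma alt_uniq b s : uniq s -> uniq (alt b s).
Proof.
by rewrite -(perm_uniq (perm_alt s)) cat_uniq; case: b => /and3P[].
Qed.

Lemma alt_disj b s x : uniq s -> x \in alt b s -> x \notin alt (~~ b) s.
Proof.
rewrite -(perm_uniq (perm_alt s)) cat_uniq => /and3P[_ /hasPn D _].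
case: b => xs; first by apply/negP=> /D /=; rewrite xs.
exact: D.
Qed.

Lemma alt_inj s t : (forall b, alt b s = alt b t) -> s = t.
Proof.
elim: s t => [|x s IHs] [|y t] st //; [by have := st true|by have := st true|].
have /= [-> Ef] := st true; congr (_ :: _); apply: IHs => -[] //.
exact: st false.
Qed.

Lemma alt_surj s t : size t <= size s <= (size t).+1 ->
  exists w, alt true w = s /\ alt false w = t.
Proof.
elim: s t => [|x s IHs] [|y t] //=.
- by exists [::].
- by case: s IHs => // _ _; exists [:: x].
move=> /IHs[w [<- <-]]; by exists [:: x, y & w].
Qed.

End Alt.

(** * The moves and their invariants *)

Section Moves.
Variable n : nat.
Implicit Types (s t u v w p q r : seq 'I_n) (b : bool) (x y z e o m : 'I_n).

(** The elementary move: three consecutive letters are reversed when the middle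
    one is not the smallest. These are the patterns 123, 321, 132 and 231. *)
Definition kstep u v := exists a c x y z,
  [/\ u = a ++ [:: x; y; z] ++ c, v = a ++ [:: z; y; x] ++ c & minn x z < y].

(** The equivalence relation generated by [kstep], which is symmetric. *)
Inductive keq u : seq 'I_n -> Prop :=
| keq_refl : keq u u
| keq_step v w : kstep u v -> keq v w -> keq u w.

Lemma kstep_sym u v : kstep u v -> kstep v u.
Proof.
by case=> a [c] [x] [y] [z] [-> -> xyz]; exists a, c, z, y, x; rewrite minnC.
Qed.

Lemma keq_trans v u w : keq u v -> keq v w -> keq u w.
Proof. by elim=> // {}u v' v'' st _ IH /IH; apply: keq_step. Qed.

Lemma kstep_keq u v : kstep u v -> keq u v.
Proof. by move=> st; exact: keq_step st (keq_refl v). Qed.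

Lemma keq_sym u v : keq u v -> keq v u.
Proof.
elim=> [|{}u v' w st _ IH]; first exact: keq_refl.
exact: keq_trans IH (kstep_keq (kstep_sym st)).
Qed.

Lemma kstep_cons x u v : kstep u v -> kstep (x :: u) (x :: v).
Proof. by case=> a [c] [x'] [y] [z] [-> -> xyz]; exists (x :: a), c, x', y, z. Qed.

Lemma keq_cons x u v : keq u v -> keq (x :: u) (x :: v).
Proof.
elim=> [|{}u v' w st _ IH]; first by move=> {}u; apply: keq_refl.
exact: keq_step (kstep_cons x st) IH.
Qed.

(** A move exchanges two neighbours [x] and [z] in one of the two alternating
    subwords and fixes the other one, which contains a letter larger than the
    minimum of [x] and [z]. *)
Lemma kstep_alt u v : kstep u v -> exists b p q x z y,
  [/\ alt b u = p ++ x :: z :: q, alt b v = p ++ z :: x :: q,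
      alt (~~ b) v = alt (~~ b) u, y \in alt (~~ b) u & minn x z < y].
Proof.
case=> a [c] [x] [y] [z] [-> -> xyz].
exists (~~ odd (size a)), (alt (~~ odd (size a)) a).
exists (alt (~~ odd (size a) (+) odd (size a) (+) true) c), x, z, y.
rewrite !alt_cat /=; case: (odd _) => /=; split=> //;
  by rewrite mem_cat inE eqxx orbT.
Qed.

(** The dominant letters of one parity: those larger than all the letters in
    positions of the other parity, listed in their order of occurrence. *)
Definition tops b s :=
  [seq x : 'I_n <- alt b s | all (fun y : 'I_n => y < x) (alt (~~ b) s)].

Lemma kstep_perm_alt b u v : kstep u v -> perm_eq (alt b u) (alt b v).
Proof.
case/kstep_alt=> b' [p] [q] [x] [z] [y] [E1 E2 E3 _ _].
have [->|nb] := eqVneq b b'.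
  by rewrite E1 E2 perm_cat2l -[x :: z :: q]/([:: x] ++ [:: z] ++ q) perm_catCA.
have -> : b = ~~ b' by move: nb; case: (b) (b') => -[].
by rewrite E3.
Qed.

(** A move never exchanges two dominant letters, since the letter between them
    is smaller than both. *)
Lemma kstep_tops b u v : kstep u v -> tops b u = tops b v.
Proof.
move=> st; rewrite /tops.
under [RHS]eq_filter => k do rewrite -(perm_all _ (kstep_perm_alt (~~ b) st)).
case/kstep_alt: st => b' [p] [q] [x] [z] [y] [E1 E2 E3 yu xyz].
have [->|nb] := eqVneq b b'; last first.
  have -> : b = ~~ b' by move: nb; case: (b) (b') => -[].
  by rewrite E3.
rewrite E1 E2 !filter_cat /=.
case: allP => [X|//]; case: allP => [Z|//].
by move: (X _ yu) (Z _ yu) xyz; lia.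
Qed.

Lemma keq_perm_alt b u v : keq u v -> perm_eq (alt b u) (alt b v).
Proof.
by elim=> // {}u v' w st _; apply: perm_trans; apply: kstep_perm_alt.
Qed.

Lemma keq_tops b u v : keq u v -> tops b u = tops b v.
Proof. by elim=> // {}u v' w st _ <-; apply: kstep_tops. Qed.

Lemma keq_perm u v : keq u v -> perm_eq u v.
Proof. by move=> uv; apply: alt_perm => b; apply: keq_perm_alt. Qed.

(** Conversely, two neighbours of an alternating subword are exchanged by a move
    as soon as the smaller one is below the letter that separates them in the
    word. That letter has index [size p] in the other subword if [b], and index
    [(size p).+1] otherwise. *)
Lemma swap_alt d b s p q x z : alt b s = p ++ x :: z :: q ->
  minn x z < nth d (alt (~~ b) s) (size p + ~~ b) ->
  exists s', [/\ kstep s s', alt b s' = p ++ z :: x :: q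
                & alt (~~ b) s' = alt (~~ b) s].
Proof.
elim: s b p => [|c s IHs] b p; first by case: b p => -[].
case: b => /=; last first.
  rewrite addn1 /= => Es lt_m; have [|s' [st E1 E2]] := IHs true p Es.
    by rewrite addn0.
  by exists (c :: s'); split=> //=; [apply: kstep_cons | rewrite E2].
case: p => [|c' p] /= [-> Es]; last first.
  rewrite addn0 => lt_m; have [|s' [st E1 E2]] := IHs false p Es.
    by rewrite addn1.
  by exists (c' :: s'); split=> //=; [apply: kstep_cons | rewrite E1].
case: s Es {IHs} => // y [|z' s] //= [-> <-] lt_m.
by exists [:: z, y, x & s]; split=> //; exists [::], s, x, y, z.
Qed.

(** * Completeness of the invariants *)

(** [e] is smaller than all the letters of [O]. For [O] the letters in odd
    positions, small letters move without obstruction in the even positions. *)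
Definition small O e := all (fun o : 'I_n => e < o) O.

Lemma swap_small s p q x z : alt false s = p ++ x :: z :: q ->
  small (alt true s) x || small (alt true s) z ->
  exists s', [/\ keq s s', alt false s' = p ++ z :: x :: q
                & alt true s' = alt true s].
Proof.
move=> Es xz; have [|s' [st E1 E2]] := @swap_alt x _ _ _ _ _ _ Es.
  have /(mem_nth x) H : size p + 1 < size (alt true s).
    rewrite size_alt; have := size_alt false s; rewrite Es size_cat /=.
    by rewrite uphalf_half; lia.
  by case/orP: xz => /allP/(_ _ H) /=; lia.
by exists s'; split=> //; apply: kstep_keq.
Qed.

(** Moving [e] to the left across a block [r]: each exchange is with a letter of
    [r], and one of the two is small. *)
Lemma shift_small s p r q e : alt false s = p ++ r ++ e :: q ->
  small (alt true s) e || all (small (alt true s)) r ->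
  exists s', [/\ keq s s', alt false s' = p ++ e :: r ++ q
                & alt true s' = alt true s].
Proof.
elim/last_ind: r s q => [|r c IHr] s q Es er.
  by exists s; split=> //; apply: keq_refl.
rewrite cat_rcons catA in Es.
have [|s1 [st1 E1 O1]] := swap_small Es.
  by case/orP: er => [->|]; rewrite ?orbT // all_rcons => /andP[->].
rewrite -catA in E1; have [|s2 [st2 E2 O2]] := IHr _ _ E1.
  by rewrite O1; case/orP: er => [->|] //; rewrite all_rcons => /andP[_ ->]; rewrite orbT.
exists s2; split; first exact: keq_trans st2.
  by rewrite E2 cat_rcons.
by rewrite O2.
Qed.

(** The even positions can be rearranged in any way that keeps the relative order
    of the letters that are not small. *)
Lemma rearrange_small s E : perm_eq (alt false s) E ->
  [seq e <- alt false s | ~~ small (alt true s) e]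
    = [seq e <- E | ~~ small (alt true s) e] ->
  exists s', [/\ keq s s', alt false s' = E & alt true s' = alt true s].
Proof.
move=> pE fE.
suff: forall p E1, alt false s = p ++ E1 -> forall E2, perm_eq E1 E2 ->
   [seq e <- E1 | ~~ small (alt true s) e]
    = [seq e <- E2 | ~~ small (alt true s) e] ->
  exists s', [/\ keq s s', alt false s' = p ++ E2 & alt true s' = alt true s].
  by move=> /(_ [::] _ erefl _ pE fE).
move=> p E1 + E2; elim: E2 s p E1 {pE fE E} => [|e E2 IH] s p E1 Es pE fE.
  exists s; split=> //; first exact: keq_refl.
  by rewrite Es; congr (_ ++ _); apply/nilP; rewrite /nilp (perm_size pE).
have [r [q [E1E er]]] : exists r q, E1 = r ++ e :: q /\
    small (alt true s) e || all (small (alt true s)) r.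
  have eE1 : e \in E1 by rewrite (perm_mem pE) mem_head.
  have [se|nse] := boolP (small (alt true s) e).
    by case/splitPr: eE1 => r q; exists r, q; split=> //; rewrite se.
  move: fE; rewrite /= nse; elim: E1 {Es pE eE1} => //= c E1 IH1.
  case: ifPn => [nsc [-> _]|/negPn sc /IH1 [r [q [-> ar]]]].
    by exists [::], E1.
  by exists (c :: r), q; rewrite /= sc ar.
rewrite {}E1E in Es pE fE.
have [s1 [st1 Es1 O1]] := shift_small Es er.
have [|||s2 [st2 Es2 O2]] := IH s1 (rcons p e) (r ++ q).
- by rewrite Es1 cat_rcons.
- by move: pE; rewrite -(cat1s e q) perm_catCA perm_cons.
- rewrite O1; move: fE; rewrite !filter_cat /=.
  case: ifP => // ne; have /orP[|/allP ar] := er; first by rewrite (negPf ne).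
  rewrite (eq_in_filter (a2 := pred0)) ?filter_pred0 /=; first by case.
  by move=> c /ar ->.
exists s2; split; first exact: keq_trans st2.
  by rewrite Es2 cat_rcons.
by rewrite O2.
Qed.

(** A letter that is not small can be brought to any even position: in the
    rearrangement [take k M ++ L ++ drop k M] of the small letters [M] and of the
    other letters [L], the letter of index [k] comes from [L]. *)
Lemma bring_large d s k : has (fun e => ~~ small (alt true s) e) (alt false s) ->
  k < size (alt false s) ->
  exists s', [/\ keq s s', perm_eq (alt false s') (alt false s),
     alt true s' = alt true s & ~~ small (alt true s) (nth d (alt false s') k)].
Proof.
set S := small _; set E := alt false s => hasL ltk.
pose L := [seq e <- E | ~~ S e]; pose M := [seq e <- E | S e].
pose E' := take k M ++ L ++ drop k M.
have pE : perm_eq E E'.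
  rewrite /E' perm_sym perm_catCA cat_take_drop perm_catC.
  exact/permPl/perm_filterC.
have [|s' [st Es' Os']] := @rearrange_small s E' pE.
  rewrite -/S -/E /E' !filter_cat -/L.
  have M0 r : {subset r <= M} -> [seq e <- r | ~~ S e] = [::].
    move=> rM; apply/eqP; rewrite -[_ == _]negbK -has_filter.
    apply/hasPn=> e /rM; by rewrite mem_filter negbK => /andP[].
  rewrite (M0 (take k M)); last by move=> e; apply: mem_take.
  rewrite (M0 (drop k M)); last by move=> e; apply: mem_drop.
  by rewrite cats0 filter_id.
exists s'; split=> //; first by rewrite Es' perm_sym.
have sz : size L + size M = size E by rewrite /L /M !size_filter addnC count_predC.
rewrite Es' nth_cat size_take_min ltnNge geq_minl /= nth_cat.
have lt : k - minn k (size M) < size L.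
  move: hasL; rewrite has_count -size_filter -/S -/E -/L; lia.
by rewrite lt; move: (mem_nth d lt); rewrite mem_filter => /andP[].
Qed.

(** The minimum [m] of the odd positions moves one step to the left once the
    letter before it is not small, hence larger than [m]. *)
Lemma min_to_front s m : uniq s ->
  m \in alt true s -> (forall o, o \in alt true s -> m <= o) ->
  has (fun e => ~~ small (alt true s) e) (alt false s) ->
  exists s', keq s (m :: s').
Proof.
move: {2}(index m (alt true s)) (erefl (index m (alt true s))) => i.
elim: i s => [|i IHi] s Ei us ms mmin hasL.
  case: s {us mmin hasL} Ei ms => [|x s] //= + _.
  by case: (eqVneq x m) => [<-|] // _; exists s; apply: keq_refl.
have lti : i.+1 < size (alt true s) by rewrite -Ei index_mem.
have ltE : i < size (alt false s).
  by move: lti; rewrite !size_alt uphalf_half; lia.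
have [s1 [st1 pE1 O1 large]] := bring_large m hasL ltE.
set e := nth _ _ _ in large.
have us1 : uniq s1 by rewrite -(perm_uniq (keq_perm st1)).
have lt_me : m < e.
  have /allPn[o os oe] := large.
  have eE : e \in alt false s1 by apply: mem_nth; rewrite (perm_size pE1).
  have := alt_disj us1 eE; rewrite /= O1 => /negP nO.
  rewrite ltn_neqAle (leq_trans (mmin _ os)) 1?leqNgt // andbT.
  by apply/eqP=> /val_inj me; apply: nO; rewrite -me.
pose p := take i (alt true s); pose x := nth m (alt true s) i.
pose q := drop i.+2 (alt true s).
have Es : alt true s = p ++ x :: m :: q.
  rewrite -{1}(cat_take_drop i (alt true s)) (drop_nth m); last exact: ltnW.
  rewrite (drop_nth m) //; congr (_ ++ _ :: _ :: _).
  by rewrite -Ei nth_index.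
have szp : size p = i by rewrite size_take_min; apply/minn_idPl; do 2!apply: ltnW.
have [||s2 [st2 E2 O2]] := @swap_alt m true s1 p q x m.
- by rewrite O1.
- by rewrite szp addn0 /= -/e; move: lt_me; lia.
have st : keq s s2 by apply: keq_trans st1 (kstep_keq st2).
have perm_t : perm_eq (alt true s2) (alt true s) by rewrite perm_sym keq_perm_alt.
have perm_f : perm_eq (alt false s2) (alt false s) by rewrite perm_sym keq_perm_alt.
have [|||||s' st'] := IHi s2.
- have ms' : m \notin p.
    have := alt_uniq true us; rewrite Es cat_uniq => /and3P[_ /hasPn/(_ m)].
    by rewrite !inE eqxx orbT => /(_ isT).
  by rewrite E2 index_cat (negPf ms') /= eqxx addn0.
- by rewrite -(perm_uniq (keq_perm st)).
- by rewrite (perm_mem perm_t).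
- by move=> o; rewrite (perm_mem perm_t); apply: mmin.
- rewrite (perm_has _ perm_f); apply: sub_has hasL => c.
  by rewrite /small (perm_all _ perm_t).
by exists s'; apply: keq_trans st'.
Qed.

Lemma perm_size_small (r r' : seq 'I_n) : perm_eq r r' -> size r <= 1 -> r = r'.
Proof. by move=> rr' sz; apply: perm_small_eq; rewrite -?(perm_size rr'). Qed.

(** Induction on the length. If all the letters in even positions are small, the
    odd positions form a dominant sequence and the even ones are rearranged
    freely. Otherwise both words are brought to the form [m :: _] with [m] the
    minimum of the odd positions, and the tails satisfy the hypotheses with the
    two parities exchanged: [m] is not dominant, and removing it makes no other
    letter dominant, because another odd position holds a larger letter. *)
Theorem keq_complete s t : uniq s -> (forall b, perm_eq (alt b s) (alt b t)) ->
  (forall b, tops b s = tops b t) -> keq s t.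
Proof.
elim: {s}(size s) {-2}s (leqnn (size s)) t => [|k IHk] s sz t us pst tst.
  suff -> : s = t by apply: keq_refl.
  by apply: perm_size_small (alt_perm pst) _; apply: leq_trans sz _.
(* With at most one letter of each parity, the two words coincide. *)
have [sz1|sz1] := leqP (size (alt true s)) 1.
  suff -> : s = t by apply: keq_refl.
  apply: alt_inj => b; apply: perm_size_small => //; apply: leq_trans sz1.
  by case: b => //; rewrite !size_alt uphalf_half leq_addl.
have [hasL|] := boolP (has (fun e => ~~ small (alt true s) e) (alt false s)); last first.
  rewrite has_predC negbK => allS.
  have topE r : (forall b, perm_eq (alt b s) (alt b r)) -> tops true r = alt true r.
    move=> pr; apply/all_filterP/allP=> o; rewrite -(perm_mem (pr true)) => os.
    rewrite -(perm_all _ (pr false)); apply/allP=> e es.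
    by have /allP/(_ o os) := allP allS e es.
  have Est : alt true s = alt true t by rewrite -!topE.
  have [|s' [st Es' Os']] := @rearrange_small s _ (pst false).
    have allS' := allS; rewrite (perm_all _ (pst false)) in allS'.
    have F r : all (small (alt true s)) r -> [seq e <- r | ~~ small (alt true s) e] = [::].
      by move=> ar; apply/eqP; rewrite -[_ == _]negbK -has_filter has_predC ar.
    by rewrite !F.
  suff <- : s' = t by [].
  by apply: alt_inj => -[] //; rewrite Os'.
have [m ms mmin] : exists2 m, m \in alt true s & forall o, o \in alt true s -> m <= o.
  case: (alt true s) sz1 => // o0 r _.
  have oo : o0 \in o0 :: r by exact: mem_head.
  by case: (arg_minnP (fun o : 'I_n => val o) oo) => m mr mmin; exists m.
have ut : uniq t by rewrite -(perm_uniq (alt_perm pst)).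
have [s1 ss1] := min_to_front us ms mmin hasL.
have [|||t1 tt1] := @min_to_front t m ut.
- by rewrite -(perm_mem (pst true)).
- by move=> o; rewrite -(perm_mem (pst true)); apply: mmin.
- rewrite -(perm_has _ (pst false)); apply: sub_has hasL => c.
  by rewrite /small (perm_all _ (pst true)).
suff st1 : keq s1 t1.
  exact: keq_trans ss1 (keq_trans (keq_cons m st1) (keq_sym tt1)).
have us1 : uniq (m :: s1) by rewrite -(perm_uniq (keq_perm ss1)).
have p1 b : perm_eq (alt b (m :: s1)) (alt b (m :: t1)).
  rewrite -(permPl (keq_perm_alt b ss1)) (permPl (pst b)).
  exact: keq_perm_alt.
have t1' b : tops b (m :: s1) = tops b (m :: t1).
  by rewrite -(keq_tops b ss1) -(keq_tops b tt1).
have topsE r : keq s (m :: r) \/ keq t (m :: r) ->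
    forall b, tops b r = tops (~~ b) (m :: r).
  move=> Hr; have pr b : perm_eq (alt b s) (alt b (m :: r)).
    by case: Hr => [/keq_perm_alt|/keq_perm_alt/(perm_trans (pst b))]; apply.
  case; rewrite /tops /=.
    have /hasP[o os] : has (fun o : 'I_n => m <= o) (alt false r).
      have : 1 < size (alt true (m :: r)) by rewrite -(perm_size (pr true)).
      move=> /= sz2; case Er: (alt false r) sz2 => [|o r'] // _.
      apply/hasP; exists o; rewrite ?mem_head //; apply: mmin.
      by rewrite (perm_mem (pr true)) /= Er !inE eqxx orbT.
    move=> mo; apply: eq_filter => x /=.
    case: allP => [/(_ o os)|_]; last by rewrite andbF.
    by rewrite andbT; move: mo; lia.
  case: allP => // X; case/hasP: hasL => e es /allPn[o os].
  rewrite (perm_mem (pr false)) /= in es.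
  by have := X e es; have := mmin o os; lia.
apply: IHk.
- by move: (perm_size (keq_perm ss1)) sz => /= ->.
- by case/andP: us1.
- by case; [apply: (p1 false) | move: (p1 true); rewrite /= perm_cons].
- by move=> b; rewrite (topsE s1) ?(topsE t1) //; [right|left].
Qed.

End Moves.

(** * Words of permutations and patterns of length three *)

Lemma size_word n (phi : 'S_n) : size (word phi) = n.
Proof. by rewrite size_map size_enum_ord. Qed.

Lemma word_uniq n (phi : 'S_n) : uniq (word phi).
Proof. by rewrite map_inj_uniq ?enum_uniq //; apply: perm_inj. Qed.

Lemma mem_word n (phi : 'S_n) x : x \in word phi.
Proof. by apply/mapP; exists (phi^-1%g x); rewrite ?mem_enum ?permKV. Qed.

Lemma word_inj n : injective (@word n).
Proof.
move=> phi psi /eq_in_map E; apply/permP=> i.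
by apply: E; rewrite mem_enum.
Qed.

Lemma word_surj n (w : seq 'I_n) : uniq w -> size w = n -> exists phi, word phi = w.
Proof.
move=> uw /eqP sw; pose t := Tuple sw.
have inj : injective (tnth t) by apply/tuple_uniqP.
exists (perm inj); rewrite /word -[RHS](map_tnth_enum t).
by apply: eq_map => i; rewrite permE.
Qed.

Section Patterns3.

Local Notation o0 := (@Ordinal 3 0 isT).
Local Notation o1 := (@Ordinal 3 1 isT).
Local Notation o2 := (@Ordinal 3 2 isT).

Lemma one_line3 (s : 'S_3) :
  [seq (val i).+1 | i <- word s] = [:: (s o0).+1; (s o1).+1; (s o2).+1].
Proof.
rewrite -map_comp (_ : enum 'I_3 = [:: o0; o1; o2]) //.
by apply: (inj_map val_inj); rewrite val_enum_ord.
Qed.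

Lemma is_order_perm3 n (s : 'S_3) a b c (x y z : 'I_n) :
  [seq (val i).+1 | i <- word s] = [:: a; b; c] ->
  is_order_perm [tuple x; y; z] s =
  [&& (a < b) == (x < y), (b < a) == (y < x), (a < c) == (x < z),
      (c < a) == (z < x), (b < c) == (y < z) & (c < b) == (z < y)].
Proof.
rewrite one_line3 => -[<- <- <-]; rewrite !ltnS.
apply/idP/idP.
  move=> /forallP H; have {}H i j := eqP (forallP (H i) j).
  have := (H o0 o1, H o1 o0, H o0 o2, H o2 o0, H o1 o2, H o2 o1).
  by rewrite !(tnth_nth x) /= => -[[[[[-> ->] ->] ->] ->] ->]; rewrite !eqxx.
case/and5P=> /eqP H1 /eqP H2 /eqP H3 /eqP H4 /andP[/eqP H5 /eqP H6].
apply/forallP=> i; apply/forallP=> j; rewrite !(tnth_nth x).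
have ord3 (k : 'I_3) : [\/ k = o0, k = o1 | k = o2].
  by case: k => -[|[|[|]]] // ?; [constructor 1|constructor 2|constructor 3]; apply: val_inj.
by case: (ord3 i) => ->; case: (ord3 j) => -> /=;
  rewrite ?H1 ?H2 ?H3 ?H4 ?H5 ?H6 ?ltnn.
Qed.

(** A word of distinct letters is determined by its set of letters and its order
    permutation, since the latter gives the rank of each letter. *)
Lemma order_perm_inj n c (u v : c.-tuple 'I_n) (s : 'S_c) :
  perm_eq u v -> is_order_perm u s -> is_order_perm v s -> u = v.
Proof.
move=> uv us vs; apply: eq_from_tnth => i.
pose rk (w : seq 'I_n) (x : 'I_n) := count (fun y : 'I_n => y < x) w.
have rkE w : is_order_perm w s -> rk w (tnth w i) = count (fun j => s j < s i) (enum 'I_c).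
  move=> /forallP ws; rewrite /rk -{1}(map_tnth_enum w) count_map.
  by apply: eq_count => j /=; rewrite (eqP (forallP (ws j) i)).
have rk_lt (x y : 'I_n) : x \in val u -> x < y -> rk u x < rk u y.
  move=> xu xy;
  rewrite /rk !(seq.permP (perm_to_rem xu)) /= ltnn xy add0n add1n ltnS.
  by apply: sub_count => z /= /ltn_trans; apply.
have E : rk u (tnth u i) = rk u (tnth v i).
  by rewrite rkE // -(rkE v) // /rk (seq.permP uv).
have tu : tnth u i \in val u by apply: mem_tnth.
have tv : tnth v i \in val u by rewrite (perm_mem uv) mem_tnth.
by apply: val_inj; case: (ltngtP (tnth u i) (tnth v i)) => // /rk_lt;
  rewrite ?tu ?tv E ltnn => /(_ isT).
Qed.

End Patterns3.

(** The set partition of S_3 whose parts with more than one element are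
    {123, 321} and {132, 231}. *)
Definition K_123_321_132_231 : {set {set 'S_3}} :=
  replacement_partition
    [set one_line 3 [:: [:: 1; 2; 3]; [:: 3; 2; 1]];
         one_line 3 [:: [:: 1; 3; 2]; [:: 2; 3; 1]]].

Section Steps.

Variable n : nat.
Local Notation K := K_123_321_132_231.

(** Replacing a factor by one with the same order permutation changes nothing;
    the two parts of size two give the reversals of [kstep]. *)
Lemma K_step_kstep (phi psi : 'S_n) :
  K_step K phi psi -> word phi = word psi \/ kstep (word phi) (word psi).
Proof.
case/existsP=> a /existsP[c] /existsP[u] /existsP[v].
case/and3P=> /eqP Ephi /eqP Epsi /existsP[P /andP[PK]].
case/existsP=> s /andP[sP] /existsP[t /and3P[tP us vt]].
have uv : perm_eq u v.
  have : perm_eq (word phi) (word psi).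
    by apply: uniq_perm; rewrite ?word_uniq // => x; rewrite !mem_word.
  by rewrite Ephi Epsi perm_cat2l perm_cat2r.
have [st|nst] := eqVneq s t.
  by left; rewrite Ephi Epsi (order_perm_inj uv us) // st.
right; rewrite {}Ephi {}Epsi.
move: PK; rewrite !inE => /orP[/orP[] /eqP PE|/imsetP[s' _ PE]]; last first.
- by move: sP tP nst; rewrite PE !inE => /eqP-> /eqP->; rewrite eqxx.
all: rewrite {}PE !inE in sP tP.
all: have{} nst : [seq (val i).+1 | i <- word s] != [seq (val i).+1 | i <- word t]
  by apply: contra nst => /eqP/(inj_map (inj_comp succn_inj val_inj))/word_inj->.
all: case/tupleP: u us uv => x u; case/tupleP: u => y u; case/tupleP: u => z u.
all: rewrite (tuple0 u) => {u} us uv.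
all: suff [vE xyz] : v = [tuple z; y; x] /\ minn x z < y
  by exists a, c, x, y, z; rewrite vE.
all: have ru : perm_eq [tuple z; y; x] v
  by apply: perm_trans uv; rewrite /= -[_ :: _]revK perm_rev.
all: case/orP: sP nst us => /eqP sE; rewrite sE;
  case/orP: tP vt => /eqP tE vt; rewrite tE // => _;
  rewrite (is_order_perm3 _ _ _ sE) /= => us.
all: split; last by move: us; lia.
all: apply/esym/(@order_perm_inj _ _ _ _ t ru) => //;
  rewrite (is_order_perm3 _ _ _ tE) /=; move: us; lia.
Qed.

Lemma one_line_exists a b c : perm_eq [:: a; b; c] [:: 1; 2; 3] ->
  exists s : 'S_3, [seq (val i).+1 | i <- word s] = [:: a; b; c].
Proof.
move=> abc; pose w := [seq (inord k.-1 : 'I_3) | k <- [:: a; b; c]].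
have wE : [seq (val i).+1 | i <- w] = [:: a; b; c].
  rewrite -map_comp map_id_in // => k; rewrite (perm_mem abc) !inE => k123.
  by rewrite /= inordK; move: k123; lia.
have [||s sw] := @word_surj 3 w; last by exists s; rewrite sw.
  have := perm_uniq abc; rewrite -wE => uw.
  by apply: (@map_uniq _ _ (fun i : 'I_3 => (val i).+1)); rewrite uw.
by rewrite size_map.
Qed.

Lemma kstep_K_step (phi psi : 'S_n) : kstep (word phi) (word psi) -> K_step K phi psi.
Proof.
case=> a [c] [x] [y] [z] [Ephi Epsi xyz].
have sz := size_word phi; rewrite Ephi !size_cat /= in sz.
have sa : size a <= n by lia.
have sc : size c <= n by lia.
have : uniq [:: x; y; z].
  by have := word_uniq phi; rewrite Ephi !cat_uniq => /and3P[_ _ /andP[]].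
rewrite /= !inE !negb_or andbT => /andP[/andP[xy xz] yz].
apply/existsP; exists (Bseq sa); apply/existsP; exists (Bseq sc).
apply/existsP; exists [tuple x; y; z]; apply/existsP; exists [tuple z; y; x].
rewrite Ephi Epsi !eqxx /=.
have main (l1 l2 : seq nat) (a1 b1 c1 : nat) :
  one_line 3 [:: l1; l2] \in K -> perm_eq [:: a1; b1; c1] [:: 1; 2; 3] ->
  [:: a1; b1; c1] \in [:: l1; l2] -> [:: c1; b1; a1] \in [:: l1; l2] ->
  [&& (a1 < b1) == (x < y), (b1 < a1) == (y < x), (a1 < c1) == (x < z),
      (c1 < a1) == (z < x), (b1 < c1) == (y < z) & (c1 < b1) == (z < y)] ->
  [exists part in K, exists s in part, exists t in part,
          is_order_perm [tuple x; y; z] s && is_order_perm [tuple z; y; x] t].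
  move=> KP p123 m1 m2 H; have [s Es] := one_line_exists p123.
  have [|t Et] := @one_line_exists c1 b1 a1.
    by rewrite -perm_rev in p123.
  apply/existsP; exists (one_line 3 [:: l1; l2]); rewrite KP /=.
  apply/existsP; exists s; rewrite inE Es m1 /=.
  apply/existsP; exists t; rewrite inE Et m2 /=.
  rewrite (is_order_perm3 _ _ _ Es) (is_order_perm3 _ _ _ Et) H /=.
  by case/and5P: H => -> -> -> -> /andP[-> ->].
have P1 : one_line 3 [:: [:: 1; 2; 3]; [:: 3; 2; 1]] \in K by rewrite !inE eqxx.
have P2 : one_line 3 [:: [:: 1; 3; 2]; [:: 2; 3; 1]] \in K by rewrite !inE eqxx orbT.
have val_neq (i j : 'I_n) : i != j -> val i != val j by [].
move: xyz (val_neq _ _ xy) (val_neq _ _ xz) (val_neq _ _ yz) => /=.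
case: (ltnP x y) (ltnP y z) (ltnP x z) => [xy'|yx'] [yz'|zy'] [xz'|zx'] *.
- by apply: (main _ _ 1 2 3 P1) => //; lia.
- by exfalso; lia.
- by apply: (main _ _ 1 3 2 P2) => //; lia.
- by apply: (main _ _ 2 3 1 P2) => //; lia.
- by exfalso; lia.
- by exfalso; lia.
- by exfalso; lia.
- by apply: (main _ _ 3 2 1 P1) => //; lia.
Qed.

End Steps.

(** * Classes as values of an invariant *)

Section Invariants.
Variable n : nat.
Local Notation K := K_123_321_132_231.

Lemma keq_K_equiv (phi psi : 'S_n) : keq (word phi) (word psi) -> K_equiv K phi psi.
Proof.
suff main u v : keq u v ->
    forall chi, word chi = u -> word psi = v -> K_equiv K chi psi.
  by move=> uv; apply: main uv _ _ _.
elim=> {u v} [u chi <- /word_inj->|].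
  exact: connect0.
move=> u v w uv _ IH chi Echi Epsi.
have pv : perm_eq u v by apply: keq_perm; apply: kstep_keq.
have [||om Eom] := @word_surj n v.
- by rewrite -(perm_uniq pv) -Echi word_uniq.
- by rewrite -(perm_size pv) -Echi size_word.
apply: connect_trans (IH om Eom Epsi).
by apply/connect1/kstep_K_step; rewrite Echi Eom.
Qed.

(** The complete invariant: the set of letters in odd positions and the two
    sequences of dominant letters, of which one is empty for n > 1. *)
Definition invariant (phi : 'S_n) :=
  ([set x in alt true (word phi)], tops true (word phi), tops false (word phi)).

Lemma mem_alt_false (phi : 'S_n) x :
  (x \in alt false (word phi)) = (x \notin alt true (word phi)).
Proof.
apply/idP/idP; first exact: (@alt_disj _ false _ _ (word_uniq phi)).
move=> nx; have := mem_word phi x.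
by rewrite -(perm_mem (perm_alt _)) mem_cat (negPf nx).
Qed.

Lemma K_equiv_invariant (phi psi : 'S_n) :
  K_equiv K phi psi = (invariant phi == invariant psi).
Proof.
apply/idP/eqP.
  case/connectP=> p + ->; elim: p phi => //= chi p IH phi /andP[st /IH <-].
  rewrite /invariant; case: (K_step_kstep st) => [->//|{}st].
  rewrite !(kstep_tops _ st); congr (_, _, _); apply/setP=> x.
  by rewrite !inE (perm_mem (kstep_perm_alt true st)).
case=> /setP A tT tF; apply/keq_K_equiv/keq_complete; rewrite ?word_uniq //.
  move=> b; apply: uniq_perm; rewrite ?alt_uniq ?word_uniq // => x.
  by have := A x; rewrite !inE; case: b; rewrite ?mem_alt_false => ->.
by case.
Qed.

End Invariants.

Lemma card_equivalence_partition (T : finType) (U : eqType) (f : T -> U) (R : rel T) :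
  (forall x y, R x y = (f x == f y)) ->
  #|equivalence_partition R setT| = size (undup [seq f x | x <- enum T]).
Proof.
move=> Rf; rewrite /equivalence_partition.
pose g x := [set y in [set: T] | R x y].
have gf x y : (g x == g y) = (f x == f y).
  apply/eqP/eqP=> [gxy|fxy]; last by apply/setP=> z; rewrite !inE !Rf fxy.
  by have /setP/(_ y) := gxy; rewrite !inE !Rf eqxx => /eqP.
transitivity (size (undup [seq g x | x <- enum T])).
  rewrite -(card_uniqP (undup_uniq _)); apply: eq_card => B.
  rewrite mem_undup; apply/imsetP/mapP=> -[x _ ->]; exists x => //.
  by rewrite mem_enum.
elim: (enum T) => //= x s IHs.
suff -> : (g x \in [seq g y | y <- s]) = (f x \in [seq f y | y <- s]).
  by case: ifP => //= _; rewrite IHs.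
by apply/mapP/mapP=> -[y ys /eqP E]; exists y => //; apply/eqP; move: E; rewrite gf.
Qed.

(** * Counting the values of the invariant *)

Section Count.
Variable n : nat.
Implicit Types (A B : {set 'I_n}).

(** The elements of [A] larger than all the elements outside [A]. *)
Definition dominant A := [set x in A | [forall y in ~: A, y < x]].

Lemma tops_dominant (phi : 'S_n) b (A := [set x in alt b (word phi)]) :
  perm_eq (tops b (word phi)) (enum (dominant A)).
Proof.
apply: uniq_perm; rewrite ?enum_uniq ?filter_uniq ?alt_uniq ?word_uniq // => x.
rewrite mem_filter mem_enum !inE andbC; congr (_ && _).
have mN y : (y \in alt (~~ b) (word phi)) = (y \in ~: A).
  by rewrite !inE; case: (b); rewrite /= ?mem_alt_false ?negbK.
by apply/allP/forall_inP => H y; move: (H y); rewrite mN.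
Qed.

(** Every choice of orders for the dominant letters is realized: list the dominant
    letters first in each parity, the remaining ones in any order, and interleave. *)
Lemma word_of_tops A t1 t2 : #|A| = uphalf n ->
  perm_eq t1 (enum (dominant A)) -> perm_eq t2 (enum (dominant (~: A))) ->
  exists phi : 'S_n, invariant phi = (A, t1, t2).
Proof.
move=> cA p1 p2.
have ext B t : perm_eq t (enum (dominant B)) ->
    exists s, [/\ perm_eq s (enum B) & [seq x <- s | x \in dominant B] = t].
  move=> pt; exists (t ++ enum (B :\: dominant B)); split.
    apply: uniq_perm; rewrite ?enum_uniq //.
      rewrite cat_uniq enum_uniq (perm_uniq pt) enum_uniq andbT /=.
      apply/hasPn=> x; rewrite mem_enum inE (perm_mem pt) mem_enum.
      by case/andP.
    move=> x; rewrite mem_cat (perm_mem pt) !mem_enum !inE.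
    by case: (x \in B) => //=; rewrite andbT orbN.
  rewrite filter_cat [X in _ ++ X](eq_in_filter (a2 := pred0)) => [|x].
    rewrite filter_pred0 cats0; apply/all_filterP/allP=> x.
    by rewrite (perm_mem pt) mem_enum.
  by rewrite mem_enum inE => /andP[/negPf].
have [O [pO fO]] := ext _ _ p1; have [E [pE fE]] := ext _ _ p2.
have sO : size O = uphalf n by rewrite (perm_size pO) -cardE.
have sE : size E = n./2.
  rewrite (perm_size pE) -cardE cardsCs setCK card_ord cA.
  by rewrite uphalf_half; lia.
have [|w [wO wE]] := @alt_surj _ O E.
  by rewrite sO sE uphalf_half; lia.
have pw : perm_eq w (enum 'I_n).
  rewrite -(permPl (perm_alt w)) wO wE; apply: uniq_perm; rewrite ?enum_uniq //.
    rewrite cat_uniq (perm_uniq pO) (perm_uniq pE) !enum_uniq andbT /=.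
    apply/hasPn=> x; rewrite (perm_mem pE) (perm_mem pO) !mem_enum.
    by rewrite inE.
  by move=> x; rewrite mem_cat (perm_mem pE) (perm_mem pO) !mem_enum !inE orbN.
have [||phi Ephi] := @word_surj n w.
- by rewrite (perm_uniq pw) enum_uniq.
- by rewrite (perm_size pw) size_enum_ord.
exists phi; rewrite /invariant Ephi /tops wO wE /= -fO -fE.
congr (_, _, _).
- by apply/setP=> x; rewrite inE (perm_mem pO) mem_enum.
- apply: eq_in_filter => x; rewrite (perm_mem pO) mem_enum => xA; rewrite [RHS]inE xA /=.
  apply/allP/forall_inP => H y; first by move=> yA; apply: H; rewrite (perm_mem pE) mem_enum.
  by rewrite (perm_mem pE) mem_enum; apply: H.
- apply: eq_in_filter => x; rewrite (perm_mem pE) mem_enum => xA; rewrite [RHS]inE xA /=.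
  rewrite setCK.
  apply/allP/forall_inP => H y; first by move=> yA; apply: H; rewrite (perm_mem pO) mem_enum.
  by rewrite (perm_mem pO) mem_enum; apply: H.
Qed.

Lemma count_invariants :
  size (undup [seq invariant phi | phi <- enum 'S_n])
  = \sum_(A : {set 'I_n} | #|A| == uphalf n) #|dominant A|`! * #|dominant (~: A)|`!.
Proof.
pose tt A := [seq (t1, t2) | t1 <- permutations (enum (dominant A)),
                             t2 <- permutations (enum (dominant (~: A)))].
pose L := [seq (A, t.1, t.2) | A <- enum [set A : {set 'I_n} | #|A| == uphalf n],
                               t <- tt A].
have uL : uniq L.
  apply: allpairs_uniq_dep; first exact: enum_uniq.
    move=> A _; apply: allpairs_uniq; rewrite ?permutations_uniq //.
    by case=> ? ? [].
  by case=> A [t1 t2] [B [t3 t4]] _ _ /= [-> -> ->].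
have -> : size (undup [seq invariant phi | phi <- enum 'S_n]) = size L.
  apply: perm_size; apply: uniq_perm; rewrite ?undup_uniq // => -[[A t1] t2].
  rewrite mem_undup; apply/mapP/allpairsPdep => [[phi _ ->]|[B [[t3 t4] []]]].
    exists [set x in alt true (word phi)], (tops true (word phi), tops false (word phi)).
    split=> //.
      rewrite mem_enum inE cardsE (card_uniqP (alt_uniq _ (word_uniq _))).
      by rewrite size_alt size_word.
    apply/allpairsP; exists (tops true (word phi), tops false (word phi)).
    rewrite !mem_permutations; split=> //=; first exact: tops_dominant.
    have -> : ~: [set x in alt true (word phi)] = [set x in alt false (word phi)].
      by apply/setP=> x; rewrite !inE mem_alt_false.
    exact: tops_dominant.
  rewrite mem_enum inE => /eqP cB /allpairsP[[t5 t6] /= [+ + [-> ->]] [-> -> ->]].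
  rewrite !mem_permutations => p1 p2.
  by have [phi <-] := word_of_tops cB p1 p2; exists phi; rewrite ?mem_enum.
rewrite size_allpairs_dep sumnE big_map big_enum /=.
apply: eq_big => [A|A _]; first by rewrite inE.
by rewrite size_allpairs !size_permutations ?enum_uniq // -!cardE.
Qed.

Lemma card_ord_ge k : #|[set x : 'I_n | k <= x]| = n - k.
Proof.
rewrite -sum1_card (eq_bigl (fun x : 'I_n => true && (k <= x))) => [|x]; last by rewrite inE.
by rewrite -(big_geq_mkord k n xpredT (fun=> 1)) sum_nat_const_nat muln1.
Qed.

(** The dominant elements of a proper subset [A] are those above the maximum of
    its complement. *)
Lemma dominant_max A z : z \notin A -> (forall y, y \notin A -> y <= z) ->
  dominant A = [set x : 'I_n | z < x].
Proof.
move=> zA zmax; apply/setP=> x; rewrite !inE; apply/andP/idP.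
  by case=> _ /forall_inP/(_ z); rewrite inE; apply.
move=> zx; split; first by apply/negPn/negP=> /zmax; lia.
by apply/forall_inP=> y; rewrite inE => /zmax; lia.
Qed.

Lemma card_dominant_max A z : z \notin A -> (forall y, y \notin A -> y <= z) ->
  #|dominant A| = n - z.+1.
Proof. by move=> zA zmax; rewrite (dominant_max zA zmax) card_ord_ge. Qed.

Lemma setC_has_max A : #|A| < n ->
  exists2 z, z \notin A & forall y, y \notin A -> y <= z.
Proof.
move=> cA; have /set0Pn[z0] : ~: A != set0.
  by rewrite -card_gt0 cardsCs setCK card_ord subn_gt0.
rewrite inE => z0A.
case: (@arg_maxnP _ _ (fun y => y \notin A) (fun y : 'I_n => val y) z0A) => z zA zmax.
by exists z.
Qed.

(** Such a set [A] contains the [j] largest letters and not the next one [z]; the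
    remaining [h - j] elements are free among the [n - j - 1] letters below [z]. *)
Lemma card_dominant_eq h j : j <= h < n ->
  #|[set A : {set 'I_n} | (#|A| == h) && (#|dominant A| == j)]| = 'C(n - j - 1, n - h - 1).
Proof.
case/andP=> jh hn.
have hz : n - j.+1 < n by lia.
pose z := Ordinal hz; pose low := [set x : 'I_n | x < z]; pose top := [set x : 'I_n | z < x].
have ctop : #|top| = j by rewrite card_ord_ge /=; lia.
have clow : #|low| = n - j.+1.
  have -> : low = ~: [set x : 'I_n | n - j.+1 <= x].
    by apply/setP=> x; rewrite !inE -ltnNge.
  by rewrite cardsCs setCK card_ord card_ord_ge; lia.
have dis B : B \subset low -> B :&: top = set0.
  move=> /subsetP Bl; apply/setP=> x; rewrite !inE; apply/negP=> /andP[/Bl].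
  by rewrite inE; lia.
have <- : 'C(#|low|, h - j) = 'C(n - j - 1, n - h - 1).
  by rewrite clow -bin_sub; [congr 'C(_, _); lia | lia].
rewrite -cards_draws.
have inj : {in [set B : {set 'I_n} | B \subset low & #|B| == h - j] &,
    injective (fun B => B :|: top)}.
  move=> B C; rewrite !inE => /andP[Bl _] /andP[Cl _] E.
  have F (X : {set 'I_n}) : X \subset low -> (X :|: top) :\: top = X.
    by move=> Xl; rewrite setDUl setDv setU0; apply/setDidPl; rewrite -setI_eq0 dis.
  by rewrite -(F B) // E F.
rewrite -(card_in_imset inj); apply: eq_card => A; rewrite !inE.
apply/andP/imsetP=> [[/eqP cA /eqP cd]|[B + ->]].
  have [|z' z'A zmax] := @setC_has_max A; first by rewrite cA.
  have Ez : z' = z.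
    apply: val_inj => /=; have := card_dominant_max z'A zmax; rewrite cd.
    by have := ltn_ord z'; lia.
  rewrite {}Ez in z'A zmax.
  have AE : A = (A :&: low) :|: top.
    apply/setP=> x; rewrite !inE; case: (ltngtP x z) => [||/val_inj->].
    - by rewrite andbT orbF.
    - by rewrite orbT => zx; apply/negPn/negP=> /zmax; lia.
    - by rewrite (negPf z'A).
  exists (A :&: low) => //; rewrite inE subsetIr /=; apply/eqP.
  by have := cA; rewrite {1}AE cardsU dis ?subsetIr // cards0 ctop subn0 => <-; rewrite addnK.
rewrite in_set => /andP[Bl /eqP cB]; split.
  by rewrite cardsU dis // cards0 cB ctop subn0 subnK.
have zB : z \notin B :|: top.
  rewrite !inE negb_or ltnn andbT; apply/negP=> /(subsetP Bl).
  by rewrite inE ltnn.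
rewrite (card_dominant_max zB) /=; first lia.
by move=> y; rewrite !inE negb_or -leqNgt => /andP[].
Qed.

(** The sum over the sets [A] of size [h] that contain the largest letter, sorted
    by their number [j] of dominant elements. *)
Lemma sum_dominant_max h (m : 'I_n) : h < n -> (forall x : 'I_n, x <= m) ->
  \sum_(A : {set 'I_n} | (#|A| == h) && (m \in A)) #|dominant A|`!
  = \sum_(1 <= j < h.+1) j`! * 'C(n - j - 1, n - h - 1).
Proof.
move=> hn mmax.
have mdom A : #|A| = h -> (m \in A) = (0 < #|dominant A|).
  move=> cA; apply/idP/idP => [mA|].
    apply/card_gt0P; exists m; rewrite inE mA; apply/forall_inP=> y.
    rewrite inE ltn_neqAle mmax andbT => yA; apply: contra yA.
    by move/eqP/val_inj->.
  case/card_gt0P=> x; rewrite inE => /andP[_ /forall_inP H].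
  by apply/negPn/negP=> mA; have := H m; rewrite inE mA => /(_ isT); have := mmax x; lia.
have domS A : #|dominant A| <= #|A| by apply/subset_leq_card/subsetP=> x; rewrite inE => /andP[].
rewrite big_nat_cond.
transitivity (\sum_(1 <= j < h.+1) \sum_(A : {set 'I_n} | (#|A| == h) && (#|dominant A| == j)) j`!).
  rewrite (exchange_big_dep (fun A : {set 'I_n} => #|A| == h)) /=; last by move=> ? ? _ /andP[].
  rewrite big_mkcondr; apply: eq_bigr => A /eqP cA /=.
  rewrite (mdom A cA) cA eqxx /=.
  have := domS A; rewrite cA => dh.
  case: posnP => [d0|dpos].
    by rewrite big_nat_cond big1 // => j; rewrite d0; lia.
  rewrite -big_filter (_ : [seq j <- _ | _] = [:: #|dominant A|]) ?big_seq1 //.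
  rewrite (eq_filter (a2 := pred1 #|dominant A|)) => [|k]; last exact: eq_sym.
  by rewrite filter_pred1_uniq ?iota_uniq // mem_index_iota dpos.
rewrite [LHS]big_nat_cond; apply: eq_bigr => j /andP[j1h _].
rewrite sum_nat_const mulnC; congr (_ * _).
by rewrite -card_dominant_eq; [apply: eq_card => A; rewrite !inE | lia].
Qed.

Lemma dominant_setC A (m : 'I_n) : (forall x : 'I_n, x <= m) -> m \in A -> dominant (~: A) = set0.
Proof.
move=> mmax mA; apply/setP=> x; rewrite !inE; apply/negP=> /andP[_ /forall_inP/(_ m)].
by rewrite !inE negbK mA => /(_ isT); have := mmax x; lia.
Qed.

End Count.

Theorem corollary3p49 (n : nat) (hn : 3 <= n) :
  let l := n./2 in
  let h := uphalf n in
  let K := replacement_partition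
             [set one_line 3 [:: [:: 1; 2; 3]; [:: 3; 2; 1]];
                  one_line 3 [:: [:: 1; 3; 2]; [:: 2; 3; 1]]] in
  num_classes n K =
    \sum_(1 <= j < l.+1) j`! * 'C(n - j - 1, h - 1)
    + \sum_(1 <= j < h.+1) j`! * 'C(n - j - 1, l - 1).
Proof.
move=> l h K.
rewrite /num_classes (card_equivalence_partition (@K_equiv_invariant n)) count_invariants.
have lh : l + h = n by rewrite /l /h uphalf_half; lia.
have l_h : l <= h by rewrite /h uphalf_half leq_addl.
have l0 : 0 < l by rewrite /l; lia.
have mlt : n.-1 < n by lia.
pose m := Ordinal mlt.
have mmax (x : 'I_n) : x <= m by rewrite /=; have := ltn_ord x; lia.
(* At most one of A and its complement has dominant elements, namely the one
   that contains the largest letter m. *)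
rewrite (bigID (fun A : {set 'I_n} => m \in A)) /= addnC; congr (_ + _).
  have -> : h - 1 = n - l - 1 by lia.
  rewrite -(sum_dominant_max _ mmax); last by lia.
  rewrite (reindex_inj (@setC_inj _)) /=; apply: eq_big => [A|A /andP[_ mA]].
    rewrite inE negbK cardsCs setCK card_ord -/h; congr (_ && _).
    move: (max_card A); rewrite card_ord; move: #|A| => a; lia.
  by rewrite setCK (dominant_setC mmax) ?cards0 ?mul1n //; move: mA; rewrite inE negbK.
have -> : l - 1 = n - h - 1 by lia.
rewrite -(sum_dominant_max _ mmax); last by lia.
by apply: eq_bigr => A /andP[_ mA]; rewrite (dominant_setC mmax) // cards0 muln1.
Qed.
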